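(* Let $N\ge 2$ be an integer, $0<\alpha<(e\pi)^{-1}$, and let $s,t$ be real numbers satisfying either $s>0,\ t\ge 0$ or $s=0,\ t>0$. Then $\omega_N$ is a minimal $N$-point $s,\log^t$-energy configuration on $\mathbb{S}^1_\alpha$ with the geodesic distance $L$ if and only if $\omega_N$ is a configuration of $N$ distinct equally spaced points on $\mathbb{S}^1_\alpha$.
   Context: $\mathbb{S}^1_\alpha:=\{x\in\mathbb{R}^2: |x|=\alpha\}$ is the circle of radius $\alpha$ centered at $0$ ($|\cdot|$ the Euclidean norm), and $L(x,y)$ is the geodesic distance on it, i.e. the length of the shorter arc of $\mathbb{S}^1_\alpha$ connecting $x$ and $y$. For a metric space $(A,d)$ and a set $\omega_N\subset A$ of $N$ distinct points, $$E^s_{\log^t}(\omega_N):=\sum_{\substack{x\ne y\\ x,y\in\omega_N}}\frac{1}{d(x,y)^s}\left(\log\frac{1}{d(x,y)}\right)^t$$ (sum over ordered pairs of distinct points; for $t=0$ the logarithmic factor is $1$). A minimal $N$-point $s,\log^t$-energy configuration on $A$ with the metric $d$ is a set $\omega_N\subset A$ of $N$ distinct points minimizing $E^s_{\log^t}$ among all sets of $N$ distinct points of $A$; here $A=\mathbb{S}^1_\alpha$, $d=L$. Points are equally spaced on the circle if consecutive ones are separated by arcs of equal length $2\pi\alpha/N$. *)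

(* Defs.v *)
From HB Require Import structures.
From mathcomp Require Import all_boot all_order all_algebra finmap.
From mathcomp Require Import all_classical all_reals all_analysis.

Set Implicit Arguments.
Unset Strict Implicit.
Unset Printing Implicit Defensive.

Import Order.TTheory GRing.Theory Num.Theory.
Import numFieldNormedType.Exports.

Local Open Scope classical_set_scope.
Local Open Scope ring_scope.

(* [powR] takes a real exponent, with x `^ 0 = 1 for every x. Its value is the
   usual power when the base is positive, so the summand has its intended
   meaning when t = 0 or when 0 < d x y < 1. *)
Definition log_energy (R : realType) (T : choiceType) (d : T -> T -> R)
    (s t : R) (w : {fset T}) : R :=
  \sum_(x <- w) \sum_(y <- w | x != y)
     ((d x y) `^ s)^-1 * (ln (d x y)^-1) `^ t.

Definition is_configuration (T : choiceType) (A : set T) (N : nat)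
    (w : {fset T}) : Prop :=
  [set` w] `<=` A /\ #|` w|%fset = N.

Definition is_minimal_configuration (R : realType) (T : choiceType)
    (A : set T) (d : T -> T -> R) (s t : R) (N : nat) (w : {fset T}) : Prop :=
  is_configuration A N w /\
  forall w' : {fset T}, is_configuration A N w' ->
    log_energy d s t w <= log_energy d s t w'.

(* The norm that the library puts on R * R is the max norm. *)
Definition euclidean_norm (R : realType) (x : R * R) : R :=
  Num.sqrt (x.1 ^+ 2 + x.2 ^+ 2).

Definition circle (R : realType) (alpha : R) : set (R * R) :=
  [set x | euclidean_norm x = alpha].

Definition circle_point (R : realType) (alpha a : R) : R * R :=
  (alpha * cos a, alpha * sin a).

(* The counterclockwise arc of central angle h starting at polar angle a goes
   from x to y; its length is alpha * h. *)
Definition is_arc (R : realType) (alpha a h : R) (x y : R * R) : Prop :=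
  [/\ 0 <= h <= 2 * pi, x = circle_point alpha a
    & y = circle_point alpha (a + h)].

(* An arc connecting x and y runs counterclockwise either from x to y or from
   y to x. For x and y on the circle the infimum is attained. *)
Definition geodesic_distance (R : realType) (alpha : R) (x y : R * R) : R :=
  inf [set l | exists a h : R,
         (is_arc alpha a h x y \/ is_arc alpha a h y x) /\ l = alpha * h].

(* y is the point of w that follows x counterclockwise, and the arc from x to
   y has central angle h (if w is a singleton, then y = x and h = 2 * pi). *)
Definition are_consecutive (R : realType) (alpha : R) (w : {fset R * R})
    (x y : R * R) (h : R) : Prop :=
  [/\ x \in w, y \in w, 0 < h
    & exists2 a, is_arc alpha a h x y
        & forall u, 0 < u < h -> circle_point alpha (a + u) \notin w].

Definition equally_spaced (R : realType) (alpha : R) (N : nat)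
    (w : {fset R * R}) : Prop :=
  forall (x y : R * R) (h : R), are_consecutive alpha w x y h ->
    alpha * h = 2 * pi * alpha / N%:R.

(* Main.v *)
Require Import Defs.
From HB Require Import structures.
From mathcomp Require Import all_boot all_order all_algebra finmap.
From mathcomp Require Import all_classical all_reals all_analysis.
From mathcomp Require Import ring lra.

Set Implicit Arguments.
Unset Strict Implicit.
Unset Printing Implicit Defensive.

Import Order.TTheory GRing.Theory Num.Theory.
Import numFieldNormedType.Exports.

Local Open Scope classical_set_scope.
Local Open Scope ring_scope.

(** Let f(r) = r^(-s) (log 1/r)^t. On ]0, 1/e[ this is exp(phi) with
    phi(r) = - s log r + t log (- log r), and phi is strictly decreasing and
    convex there: its derivative is - (s/r + t/(r log(1/r))), and r log(1/r)
    increases up to 1/e. So f is strictly decreasing and lies strictly above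
    each of its tangents ([riesz_log_tangent]). The bound on alpha puts every
    geodesic distance, at most alpha * pi, inside this interval.

    An N-point configuration is given by increasing angles theta_0, ...,
    theta_(N-1) spanning less than one turn, and the distance between the
    points i and j is alpha times the shorter of the two arcs of angles h and
    2 pi - h, where h = theta_j - theta_i ([geodesic_distanceE]). Compare h
    with its value p = 2 pi (j - i)/N at the equally spaced configuration.
    As f decreases, replacing the shorter arc by the arc that is shorter in the
    equally spaced configuration only lowers the tangent bound, so

      potential h >= potential p + c (h - p),  strictly unless h = p,

    with c depending only on the residue k = j - i mod N, and odd in k
    ([potential_pair]). Writing h - p = e_j - e_i, where e_i is the deviation
    of theta_i, the sum of the linear terms over all ordered pairs vanishes,
    because the coefficient of each e_i is plus or minus the sum of an odd
    function over the group Z/N ([odd_slopes_balanced]). Hence the equally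
    spaced angles minimize the energy, and equality forces all the e_i to
    coincide ([equal_angles_energy_le], [angle_energy_le_eq]). Finally, equal
    gaps between consecutive points on the circle amount to this form of the
    angles ([equally_spaced_angles], [angles_equally_spaced]). *)

(** * Strict convexity of the interaction *)

Section Interaction.
Variables (R : realType) (s t : R).
Hypothesis hst : (0 < s /\ 0 <= t) \/ (s = 0 /\ 0 < t).

Definition riesz_log (r : R) : R := (r `^ s)^-1 * (ln r^-1) `^ t.

Definition log_riesz_log (r : R) : R := - s * ln r + t * ln (- ln r).

(** Minus the derivative of [log_riesz_log]. *)
Definition log_slope (r : R) : R := s / r + t / (r * - ln r).

Lemma ln_ltN1 (r : R) : 0 < r < expR (-1) -> ln r < -1.
Proof.
by move=> /andP[r0 r1]; rewrite -(expRK (-1)) ltr_ln ?posrE ?expR_gt0.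
Qed.

Lemma riesz_logE (r : R) : 0 < r < expR (-1) ->
  riesz_log r = expR (log_riesz_log r).
Proof.
move=> hr; have lr := ln_ltN1 hr; case/andP: hr => r0 _.
have lr0 : 0 < - ln r by lra.
rewrite /riesz_log lnV ?posrE// /powR !gt_eqF// /log_riesz_log expRD mulNr.
by rewrite expRN.
Qed.

Lemma is_derive_log_riesz_log (r : R) : 0 < r < expR (-1) ->
  is_derive r 1 log_riesz_log (- log_slope r).
Proof.
move=> hr; have lr := ln_ltN1 hr; case/andP: hr => r0 _.
have lr0 : 0 < - ln r by lra.
have d1 := is_derive1_ln r0.
have d2 := is_derive1_ln lr0.
have d3 : is_derive r 1 (fun x => ln (- ln x)) ((- ln r)^-1 * - r^-1).
  exact: (@is_derive1_comp _ (@ln R) (fun x => - ln x)).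
have -> : log_riesz_log = (- s) \*: (@ln R) + t \*: (fun x => ln (- ln x)).
  by [].
apply: is_derive_eq; rewrite /log_slope /GRing.scale /=.
by field; rewrite (gt_eqF r0) lt_eqF //; lra.
Qed.

Lemma log_slope_gt0 (r : R) : 0 < r < expR (-1) -> 0 < log_slope r.
Proof.
move=> hr; have lr := ln_ltN1 hr; case/andP: hr => r0 _.
have lr0 : 0 < r * - ln r by rewrite mulr_gt0//; lra.
case: hst => -[s0 t0].
  by rewrite ltr_wpDr ?divr_gt0 ?divr_ge0 // ltW.
by rewrite /log_slope s0 mul0r add0r divr_gt0.
Qed.

(** Convexity of [log_riesz_log]. The term s/r is nonincreasing; for the
    other one, with a = - ln y and b = - ln x, so that 1 < a < b, one has
    b/a = 1 + (b - a)/a <= 1 + (b - a) <= exp(b - a), that is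
    x * - ln x <= y * - ln y. This is where the bound 1/e enters. *)
Lemma log_slope_le (x y : R) : 0 < x -> x < y -> y < expR (-1) ->
  log_slope y <= log_slope x.
Proof.
move=> x0 xy ye; have y0 := lt_trans x0 xy.
have ly : ln y < -1 by rewrite ln_ltN1 ?y0.
have lx : ln x < -1 by rewrite ln_ltN1 ?x0 ?(lt_trans xy ye).
have st : 0 <= s /\ 0 <= t by case: hst => -[s0 t0]; split; lra.
have lxy : ln x < ln y by rewrite ltr_ln.
have xly : x * - ln x <= y * - ln y.
  rewrite mulrC -ler_pdivlMr// [leRHS]mulrAC -ler_pdivrMr; last by lra.
  have yx : 0 < y / x by rewrite divr_gt0.
  rewrite -[leRHS](lnK yx) ln_div//.
  apply: le_trans (expR_ge1Dx _).
  rewrite ler_pdivrMr; last by lra.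
  have : 0 <= (ln y - ln x) * (- ln y - 1) by rewrite mulr_ge0//; lra.
  lra.
rewrite /log_slope lerD// ler_wpM2l ?st.1 ?st.2//.
  by rewrite lef_pV2 ?posrE ?ltW.
rewrite lef_pV2 ?posrE// mulr_gt0//; lra.
Qed.

Lemma log_riesz_log_MVT (x y : R) : 0 < x -> x < y -> y < expR (-1) ->
  exists2 c, x < c < y &
    log_riesz_log y - log_riesz_log x = - log_slope c * (y - x).
Proof.
move=> x0 xy ye.
have dom z : x <= z <= y -> 0 < z < expR (-1).
  by move=> /andP[xz zy]; rewrite (lt_le_trans x0)// (le_lt_trans zy).
have [||c cxy E] := @MVT R log_riesz_log (fun z => - log_slope z) _ _ xy.
- by move=> z zxy; apply/is_derive_log_riesz_log/dom; rewrite !(itvP zxy).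
- apply: derivable_within_continuous => z zxy.
  by have [] := is_derive_log_riesz_log (dom z zxy).
- by exists c; rewrite // !(itvP cxy).
Qed.

(** The strict inequality 1 + d < exp d, at the nonzero increment d of the
    convex function [log_riesz_log], absorbs the passage from log-convexity to
    strict convexity; d is nonzero because [log_riesz_log] is strictly
    monotone. *)
Lemma riesz_log_tangent (x y : R) :
  0 < x < expR (-1) -> 0 < y < expR (-1) -> y != x ->
  riesz_log x - riesz_log x * log_slope x * (y - x) < riesz_log y.
Proof.
move=> hx hy yx.
suff [dn0 dge] : log_riesz_log y - log_riesz_log x != 0 /\
    - log_slope x * (y - x) <= log_riesz_log y - log_riesz_log x.
  rewrite !riesz_logE// -[log_riesz_log y](subrK (log_riesz_log x)).
  rewrite [ltRHS]expRD.
  set d := _ - _ in dn0 dge *; set e := expR (log_riesz_log x).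
  rewrite [ltRHS]mulrC -mulrA -[X in X - _]mulr1 -mulrBr ltr_pM2l ?expR_gt0//.
  by apply: le_lt_trans (expR_gt1Dx dn0); lra.
case/andP: (hx) => x0 xe; case/andP: (hy) => y0 ye.
case: (ltgtP y x) yx => // [yx|xy] _.
- have [c /andP[yc cx] E] := log_riesz_log_MVT y0 yx xe.
  have c0 : 0 < log_slope c.
    by rewrite log_slope_gt0// (lt_trans y0)// (lt_trans cx).
  have le := log_slope_le (lt_trans y0 yc) cx xe.
  have : 0 <= (log_slope c - log_slope x) * (x - y).
    by rewrite mulr_ge0 ?subr_ge0 ?(ltW yx).
  split; last by lra.
  by rewrite -opprB oppr_eq0 E mulf_neq0// ?oppr_eq0 ?subr_eq0 gt_eqF.
- have [c /andP[xc cy] E] := log_riesz_log_MVT x0 xy ye.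
  have c0 : 0 < log_slope c.
    by rewrite log_slope_gt0// (lt_trans x0)// (lt_trans cy).
  have le := log_slope_le x0 xc (lt_trans cy ye).
  have : 0 <= (log_slope x - log_slope c) * (y - x).
    by rewrite mulr_ge0 ?subr_ge0 ?(ltW xy).
  split; last by lra.
  by rewrite E mulf_neq0// ?oppr_eq0 ?subr_eq0 gt_eqF.
Qed.
End Interaction.

(** * Arcs and distances on the circle *)

Section Circle.
Variable R : realType.
Implicit Types (alpha a b h : R) (x y : R * R).

Lemma acos_cosE h : 0 <= h <= 2 * pi ->
  acos (cos h) = Num.min h (2 * pi - h).
Proof.
move=> /andP[h0 h2]; case: (leP h pi) => hpi.
  by rewrite cosK ?in_itv/= ?h0// min_l//; lra.
rewrite min_r; last by lra.
have -> : cos h = cos (2 * pi - h).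
  by rewrite -[RHS]cosN opprB -[RHS]cosD2pi; congr cos; rewrite mulr2n; lra.
by rewrite cosK// in_itv/=; apply/andP; split; lra.
Qed.

Lemma cos_eq1 h : `|h| < 2 * pi -> cos h = 1 -> h = 0.
Proof.
move=> h2 ch; have := @acos_cosE `|h|.
rewrite cos_norm ch acos1 normr_ge0 ltW// => /(_ isT).
by rewrite minEle; case: ifP => _ E; apply: normr0_eq0; lra.
Qed.

Lemma circle_pointD alpha a b h : alpha != 0 ->
  circle_point alpha a = circle_point alpha b ->
  circle_point alpha (a + h) = circle_point alpha (b + h).
Proof.
move=> al0 [/(mulfI al0) ca /(mulfI al0) sa].
by rewrite /circle_point !cosD !sinD ca sa.
Qed.

Lemma cosB_circle_point alpha a b c d : alpha != 0 ->
  circle_point alpha a = circle_point alpha b ->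
  circle_point alpha c = circle_point alpha d ->
  cos (c - a) = cos (d - b).
Proof.
move=> al0 [/(mulfI al0) ca /(mulfI al0) sa] [/(mulfI al0) cc /(mulfI al0) sc].
by rewrite !cosB ca sa cc sc.
Qed.

Lemma circle_pointD2pi alpha a :
  circle_point alpha (a + 2 * pi) = circle_point alpha a.
Proof.
by rewrite /circle_point mulr_natl cosD2pi sinD2pi.
Qed.

Lemma circle_point2piB alpha a :
  circle_point alpha (2 * pi - a) = (alpha * cos a, - (alpha * sin a)).
Proof.
by rewrite addrC circle_pointD2pi /circle_point cosN sinN mulrN.
Qed.

Lemma circle_point_inj alpha a b : alpha != 0 -> `|b - a| < 2 * pi ->
  circle_point alpha a = circle_point alpha b -> a = b.
Proof.
move=> al0 ab E; apply/esym/subr0_eq/cos_eq1 => //.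
by rewrite (cosB_circle_point al0 E erefl) subrr cos0.
Qed.

Lemma circle_pointP alpha x : 0 < alpha -> circle alpha x ->
  exists2 a, 0 <= a < 2 * pi & x = circle_point alpha a.
Proof.
move=> al0; rewrite /circle /euclidean_norm /= => xal.
have al1 : alpha != 0 by rewrite gt_eqF.
have x2 : x.1 ^+ 2 + x.2 ^+ 2 = alpha ^+ 2.
  by rewrite -xal sqr_sqrtr// addr_ge0 ?sqr_ge0.
set c := x.1 / alpha.
have c2 : 1 - c ^+ 2 = (x.2 / alpha) ^+ 2.
  by rewrite /c !expr_div_n; apply: (mulIf (expf_neq0 2 al1));
    rewrite mulrBl !divfK ?expf_neq0//; lra.
have c1 : -1 <= c <= 1.
  rewrite -ler_norml -(@expr_le1 _ 2)// real_normK ?num_real//.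
  by have := sqr_ge0 (x.2 / alpha); lra.
have xc : x.1 = alpha * cos (acos c) by rewrite acosK// mulrC divfK.
have xs : `|x.2| = alpha * sin (acos c).
  rewrite sin_acos// c2 sqrtr_sqr normrM normfV (gtr0_norm al0).
  by rewrite mulrC divfK.
have cpi := acos_lepi c1; have c0 := acos_ge0 c1; have pi0 := pi_gt0 R.
have [y0|y0] := leP 0 x.2.
  exists (acos c); first by apply/andP; split; lra.
  by rewrite /circle_point -xc -xs ger0_norm// -surjective_pairing.
exists (2 * pi - acos c).
  suff : acos c != 0 by move=> /eqP cn0; apply/andP; split; lra.
  apply/eqP => E; move: xs; rewrite E sin0 mulr0 => /normr0_eq0; lra.
rewrite circle_point2piB -xc -xs ltr0_norm// opprK -surjective_pairing.
by [].
Qed.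

(** All arcs joining the two points, in either direction, have a central
    angle with the same cosine, and [acos] selects the one in [0, pi]. The sign
    of the sine of b - a decides from which end point the shorter arc runs
    counterclockwise. *)
Lemma geodesic_distanceE alpha a b : 0 < alpha ->
  geodesic_distance alpha (circle_point alpha a) (circle_point alpha b) =
  alpha * acos (cos (b - a)).
Proof.
move=> al0; have al1 : alpha != 0 by rewrite gt_eqF.
rewrite /geodesic_distance; set S := (X in inf X).
have c1 := conj (cos_geN1 (b - a)) (cos_le1 (b - a)); move/andP in c1.
have lbS : lbound S (alpha * acos (cos (b - a))).
  move=> _ /= [a' [h [arcs ->]]]; rewrite ler_pM2l//.
  have [h02 ->] : 0 <= h <= 2 * pi /\ cos (b - a) = cos h.
    case: arcs => -[h02 Ea Eb]; split=> //.
      by rewrite (cosB_circle_point al1 Ea Eb) addrAC subrr add0r.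
    by rewrite -cosN opprB (cosB_circle_point al1 Ea Eb) addrAC subrr add0r.
  by rewrite acos_cosE// ge_min lexx.
suff Sd : S (alpha * acos (cos (b - a))).
  apply/eqP; rewrite eq_le lb_le_inf ?andbT//.
    by apply: ge_inf => //; exists (alpha * acos (cos (b - a))).
  by exists (alpha * acos (cos (b - a))).
set d := acos _.
have d02 : 0 <= d <= 2 * pi.
  by rewrite acos_ge0//= (le_trans (acos_lepi c1))//; have := pi_gt0 R; lra.
have cd : cos d = cos (b - a) by rewrite acosK.
have sd : sin d = `|sin (b - a)|.
  by rewrite sin_acos// -sin2cos2 sqrtr_sqr.
have [s0|s0] := leP 0 (sin (b - a)).
  exists a, d; split=> //; left; split=> //.
  rewrite (ger0_norm s0) in sd.
  by rewrite /circle_point (cosD a d) (sinD a d) sd cd -cosD -sinD addrC subrK.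
exists b, d; split=> //; right; split=> //.
rewrite (ltr0_norm s0) -sinN opprB in sd; rewrite -[RHS]cosN opprB in cd.
by rewrite /circle_point (cosD b d) (sinD b d) sd cd -cosD -sinD addrC subrK.
Qed.
End Circle.

(** * Configurations as increasing angles *)

Section Configurations.
Variables (R : realType) (alpha : R).
Hypothesis alpha_gt0 : 0 < alpha.

(** Only differences are constrained, not a fundamental domain for the
    angles, so that the condition is stable under rotation. *)
Definition increasing_lap n (theta : 'I_n -> R) : Prop :=
  forall i j : 'I_n, (i < j)%N -> 0 < theta j - theta i < 2 * pi.

Definition points_at n (theta : 'I_n -> R) : seq (R * R) :=
  [seq circle_point alpha (theta i) | i : 'I_n].

Lemma mem_points_at n (theta : 'I_n -> R) (i : 'I_n) :
  circle_point alpha (theta i) \in points_at theta.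
Proof. by apply: map_f; rewrite mem_enum. Qed.

Lemma points_at_inj n (theta : 'I_n -> R) : increasing_lap theta ->
  injective (fun i => circle_point alpha (theta i)).
Proof.
move=> lap i j E; apply: val_inj => /=.
have al0 : alpha != 0 by rewrite gt_eqF.
case: (ltngtP i j) => // ij; have := lap _ _ ij => /andP[gt lt].
  have th : `|theta j - theta i| < 2 * pi by rewrite gtr0_norm.
  by move: gt; rewrite (circle_point_inj al0 th E) subrr ltxx.
have th : `|theta j - theta i| < 2 * pi by rewrite distrC gtr0_norm.
by move: gt; rewrite (circle_point_inj al0 th E) subrr ltxx.
Qed.

Lemma points_at_uniq n (theta : 'I_n -> R) : increasing_lap theta ->
  uniq (points_at theta).
Proof.
by move=> lap; rewrite map_inj_uniq ?enum_uniq//; exact: points_at_inj.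
Qed.

Lemma points_at_configuration n (theta : 'I_n -> R) : increasing_lap theta ->
  exists2 w : {fset R * R}, is_configuration (circle alpha) n w
    & perm_eq w (points_at theta).
Proof.
move=> lap; pose w := seq_fset tt (points_at theta).
have pw : perm_eq w (points_at theta).
  by rewrite (perm_trans (seq_fset_perm tt _))// undup_id// points_at_uniq.
exists w => //; split.
  move=> x /=; rewrite (perm_mem pw) => /mapP[i _ ->].
  rewrite /circle /euclidean_norm /= !exprMn -mulrDr cos2Dsin2 mulr1.
  by rewrite sqrtr_sqr gtr0_norm.
by rewrite (perm_size pw) size_map size_enum_ord.
Qed.

(** Sort the polar angles, taken in [0, 2 pi[. *)
Lemma configuration_points_at n (w : {fset R * R}) :
  is_configuration (circle alpha) n w ->
  exists2 theta : 'I_n -> R, increasing_lap theta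
    & perm_eq w (points_at theta).
Proof.
move=> [wc wn].
have /choice[ang angP] : forall x : R * R, exists a : R, x \in w ->
    0 <= a < 2 * pi /\ x = circle_point alpha a.
  move=> x; case: (boolP (x \in w)) => [/wc|_]; last by exists 0.
  by move=> /(circle_pointP alpha_gt0)[a]; exists a.
pose r := sort <=%R [seq ang x | x <- w].
have pr : perm_eq r [seq ang x | x <- w] by rewrite perm_sort.
have sr : size r = n by rewrite size_sort size_map -wn.
have angK : {in w, cancel ang (circle_point alpha)}.
  by move=> x /angP[].
have ur : uniq r.
  by rewrite sort_uniq map_inj_in_uniq ?fset_uniq//; exact: can_in_inj angK.
have sor : sorted <%R r.
  by rewrite lt_sorted_uniq_le ur sort_le_sorted.
have rb i : (i < n)%N -> 0 <= r`_i < 2 * pi.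
  rewrite -sr => /(mem_nth 0); rewrite (perm_mem pr) => /mapP[x xw ->].
  by have [] := angP x xw.
exists (fun i : 'I_n => r`_i).
  move=> i j ij; rewrite subr_gt0 lt_sorted_ltn_nth ?inE ?sr// ij/=.
  by have := rb i (ltn_ord i); have := rb j (ltn_ord j); lra.
have -> : points_at (fun i : 'I_n => r`_i) =
    [seq circle_point alpha a | a <- [seq r`_(val i) | i <- enum 'I_n]].
  by rewrite -map_comp.
have -> : [seq r`_(val i) | i <- enum 'I_n] = r.
  apply: (@eq_from_nth _ 0); first by rewrite size_map size_enum_ord.
  move=> i; rewrite size_map size_enum_ord => ii.
  by rewrite (nth_map (Ordinal ii)) ?size_enum_ord//= nth_enum_ord.
rewrite perm_sym (perm_trans (perm_map _ pr))// -map_comp.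
by rewrite map_id_in// => x; exact: angK.
Qed.

Lemma log_energy_points_at n (s t : R) (theta : 'I_n -> R) (w : {fset R * R}) :
  increasing_lap theta -> perm_eq w (points_at theta) ->
  log_energy (geodesic_distance alpha) s t w =
  \sum_(i < n) \sum_(j < n | i != j)
     riesz_log s t (alpha * acos (cos (theta j - theta i))).
Proof.
move=> lap pw; rewrite /log_energy (perm_big _ pw)/= big_map big_enum/=.
apply: eq_bigr => i _; rewrite (perm_big _ pw)/= big_map big_enum_cond/=.
apply: eq_big => [j|j _]; first by rewrite (inj_eq (points_at_inj lap)).
by rewrite geodesic_distanceE.
Qed.
End Configurations.

(** * Energy of increasing angles *)

Lemma val_ord_sub n (i j : 'I_n.+1) : (i <= j)%N -> val (j - i)%R = (j - i)%N.
Proof.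
move=> ij; have ni := ltn_ord i; rewrite /= modnDmr addnBA 1?ltnW//.
rewrite addnC -addnBA// modnDl modn_small//.
by rewrite (leq_ltn_trans (leq_subr _ _)).
Qed.

(** Collecting the terms in e i leaves sums of c over a full set of residues,
    which vanish since k and - k contribute opposite values. The indices are
    subtracted in Z/(n+1). *)
Lemma odd_slopes_balanced (R : realDomainType) n (c e : 'I_n.+1 -> R) :
  (forall k, c (- k) = - c k) ->
  \sum_(i < n.+1) \sum_(j < n.+1) c (j - i) * (e j - e i) = 0.
Proof.
move=> codd; have c0 : \sum_k c k = 0.
  have : \sum_k c k = - \sum_k c k.
    by rewrite {1}(reindex_inj oppr_inj) -sumrN; apply: eq_bigr => k _.
  by lra.
transitivity (\sum_(i < n.+1) \sum_(j < n.+1) c (j - i) * e j -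
              \sum_(i < n.+1) \sum_(j < n.+1) c (j - i) * e i).
  rewrite -sumrB; apply: eq_bigr => i _; rewrite -sumrB.
  by apply: eq_bigr => j _; rewrite mulrBr.
have -> : \sum_(i < n.+1) \sum_(j < n.+1) c (j - i) * e i = 0.
  apply: big1 => i _; rewrite -mulr_suml.
  rewrite -[X in X * _](reindex_inj (addIr (- i)) (P := xpredT) (F := c)).
  by rewrite c0 mul0r.
rewrite exchange_big big1 ?subrr// => j _; rewrite -mulr_suml.
have inj : injective (fun i : 'I_n.+1 => j - i).
  by move=> i i' /addrI/oppr_inj.
by rewrite -[X in X * _](reindex_inj inj (P := xpredT) (F := c)) c0 mul0r.
Qed.

Section Energy.
Variables (R : realType) (alpha s t : R).
Hypothesis alpha_gt0 : 0 < alpha.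
Hypothesis alpha_lt : alpha * pi < expR (-1).
Hypothesis hst : (0 < s /\ 0 <= t) \/ (s = 0 /\ 0 < t).

(** The interaction of two points whose polar angles differ by h, for any real
    h: [acos (cos h)] is the central angle of the shorter arc. *)
Definition potential (h : R) : R := riesz_log s t (alpha * acos (cos h)).

(** The slope of a support line of [potential] at p in ]0, pi]. For p < pi it is
    the derivative of [potential]. At p = pi the graph has a convex kink and
    every slope between the two one-sided derivatives is admissible; the value
    0 is the one that makes the slopes odd. *)
Definition short_slope (p : R) : R :=
  if p < pi then
    - (alpha * (riesz_log s t (alpha * p) * log_slope s t (alpha * p)))
  else 0.

(** Extension of [short_slope] to ]0, 2 pi[ by the symmetry of [potential]
    about pi: at most one of the two terms is nonzero. *)
Definition arc_slope (p : R) : R := short_slope p - short_slope (2 * pi - p).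

Lemma potentialB a b : potential (a - b) = potential (b - a).
Proof. by rewrite /potential -cosN opprB. Qed.

Lemma potential2piB h : potential (2 * pi - h) = potential h.
Proof.
rewrite /potential -[in RHS]cosN -[in RHS]cosD2pi.
by congr (riesz_log _ _ (_ * acos (cos _))); rewrite mulr2n; lra.
Qed.

(** Let d be the angle of the shorter arc of h. The tangent at p bounds
    [potential h] below by a decreasing affine function of d, hence, as d <= h,
    by the same function of h. If d = p while h <> p, this second step is
    strict. For p = pi, the bound with slope 0 follows since d <= pi. *)
Lemma potential_short_tangent (p h : R) :
  0 < p <= pi -> 0 < h < 2 * pi -> h != p ->
  potential p + short_slope p * (h - p) < potential h.
Proof.
move=> /andP[p0 ppi] /andP[h0 h2] hp.
rewrite /potential acos_cosE; last by apply/andP; split; lra.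
rewrite acos_cosE; last by apply/andP; split; lra.
rewrite [Num.min p _]min_l; last by lra.
set d := Num.min h _.
have dom r : 0 < r <= pi -> 0 < alpha * r < expR (-1).
  move=> /andP[r0 rpi]; rewrite mulr_gt0//=; apply: le_lt_trans alpha_lt.
  by rewrite ler_pM2l.
have [d0 dpi dh] : [/\ 0 < d, d <= pi & d <= h].
  by rewrite /d; case: (leP h); split; lra.
have dp := dom p; have dd := dom d.
rewrite p0 ppi in dp; rewrite d0 dpi in dd; have {}dp := dp isT.
have {}dd := dd isT.
have m0 : 0 < alpha * (riesz_log s t (alpha * p) * log_slope s t (alpha * p)).
  by rewrite mulr_gt0// mulr_gt0 ?(log_slope_gt0 hst)// riesz_logE// expR_gt0.
have tangent : d != p -> riesz_log s t (alpha * p) -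
    alpha * (riesz_log s t (alpha * p) * log_slope s t (alpha * p)) * (d - p)
    < riesz_log s t (alpha * d).
  move=> dp1; apply: le_lt_trans (riesz_log_tangent hst dp dd _).
    by rewrite le_eqVlt; apply/orP; left; apply/eqP; ring.
  by rewrite (inj_eq (mulfI _))// gt_eqF.
rewrite /short_slope; set m := alpha * (_ * _) in m0 tangent *.
have [dep|dp1] := eqVneq d p.
  (* Here h is the longer arc: h = 2 pi - p, and p < pi. *)
  have hltd : p < h by rewrite lt_neqAle eq_sym hp -{1}dep.
  rewrite ifT.
    have : 0 < m * (h - p) by rewrite mulr_gt0 ?subr_gt0.
    by rewrite dep; lra.
  move: dep; rewrite /d; case: (leP h) => ? ?; lra.
have {tangent}tg := tangent dp1; case: (ltP p pi) => ppi'.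
  have : 0 <= m * (h - d) by rewrite mulr_ge0 ?subr_ge0 ?(ltW m0).
  lra.
have : 0 <= m * (p - d).
  by rewrite mulr_ge0 ?subr_ge0 ?(ltW m0)// (le_trans dpi).
lra.
Qed.

Lemma potential_tangent (p h : R) :
  0 < p < 2 * pi -> 0 < h < 2 * pi -> h != p ->
  potential p + arc_slope p * (h - p) < potential h.
Proof.
move=> /andP[p0 p2] hh hp; rewrite /arc_slope.
have [ppi|ppi] := leP p pi.
  rewrite [short_slope (2 * pi - p)]/short_slope ifF ?subr0.
    by apply: potential_short_tangent => //; rewrite p0.
  by apply/negbTE; rewrite -leNgt; lra.
rewrite [short_slope p]/short_slope ifF ?sub0r; last by rewrite ltNge ltW.
rewrite -(potential2piB p) -(potential2piB h).
have := @potential_short_tangent (2 * pi - p) (2 * pi - h).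
have -> : (2 * pi - h) - (2 * pi - p) = - (h - p) by ring.
rewrite mulNr mulrN; apply; last by apply/eqP => E; case/eqP: hp; lra.
  by apply/andP; split; lra.
by case/andP: hh => *; apply/andP; split; lra.
Qed.

Definition angle_energy n (theta : 'I_n -> R) : R :=
  \sum_(i < n) \sum_(j < n | i != j) potential (theta j - theta i).

Definition equal_angles n (i : 'I_n) : R := 2 * pi * i%:R / n%:R.

Lemma equal_angles_lap n : increasing_lap (@equal_angles n).
Proof.
move=> i j ij.
have n0 : 0 < n%:R :> R by rewrite ltr0n (leq_trans _ (ltn_ord i)).
have pi0 := pi_gt0 R.
have jn : j%:R < n%:R :> R by rewrite ltr_nat.
have i0 : 0 <= i%:R :> R by [].
have ijR : i%:R < j%:R :> R by rewrite ltr_nat.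
rewrite /equal_angles -mulrBl -mulrBr ltr_pdivrMr//.
rewrite divr_gt0 ?mulr_gt0 ?subr_gt0//= ltr_pM2l ?mulr_gt0//; lra.
Qed.

Lemma equal_angles_sub n (i j : 'I_n.+1) : (i <= j)%N ->
  equal_angles (j - i) = equal_angles j - equal_angles i.
Proof.
by move=> ij; rewrite /equal_angles val_ord_sub// natrB// -mulrBl -mulrBr.
Qed.

Lemma equal_anglesN n (k : 'I_n.+1) : k != 0 ->
  equal_angles (- k) = 2 * pi - equal_angles k.
Proof.
move=> k0; have kn := ltn_ord k; rewrite /equal_angles /=.
rewrite modn_small; last by rewrite ltn_subrL andbT lt0n; exact: k0.
rewrite natrB ?(ltnW kn)// mulrBr mulrBl mulfK//.
Qed.

(** The support slope at the equally spaced angle of residue k mod n + 1; the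
    antisymmetric form makes it odd, and covers k = 0 with the value 0. *)
Definition residue_slope n (k : 'I_n.+1) : R :=
  short_slope (equal_angles k) - short_slope (equal_angles (- k)).

Lemma residue_slopeN n (k : 'I_n.+1) : residue_slope (- k) = - residue_slope k.
Proof. by rewrite /residue_slope opprK opprB. Qed.

(** The tangent inequality is stated for angles in ]0, 2 pi[, hence for i < j;
    the other case is the same inequality for the pair (j, i), since [potential]
    is even and [residue_slope] odd. *)
Lemma potential_pair n (theta : 'I_n.+1 -> R) (i j : 'I_n.+1) :
  increasing_lap theta -> i != j ->
  theta j - theta i != equal_angles j - equal_angles i ->
  potential (equal_angles j - equal_angles i) +
    residue_slope (j - i) *
      ((theta j - equal_angles j) - (theta i - equal_angles i)) <
  potential (theta j - theta i).
Proof.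
move=> lap; wlog ij : i j / (i < j)%N => [hw|_ ne].
  move=> ij ne; have [lt|] := ltnP i j; first exact: hw.
  rewrite leq_eqVlt eq_sym (negPf ij : (val i == val j) = false) /= => lt.
  rewrite (potentialB (equal_angles j)) (potentialB (theta j)).
  rewrite -[j - i]opprB residue_slopeN.
  have -> (a b : R) : - residue_slope (i - j) * (a - b) =
      residue_slope (i - j) * (b - a) by ring.
  apply: hw => //; first by rewrite eq_sym.
  by apply: contra ne => /eqP E; apply/eqP; lra.
have := @potential_tangent (equal_angles (j - i)) (theta j - theta i).
have jin0 : j - i != 0 by rewrite subr_eq0 -val_eqE /= gtn_eqF.
rewrite /arc_slope -equal_anglesN// -/(residue_slope _).
rewrite equal_angles_sub ?(ltnW ij)//.
move=> /(_ (equal_angles_lap ij) (lap _ _ ij) ne).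
by congr (_ + _ * _ < _); ring.
Qed.


Definition energy_gap n (theta : 'I_n.+1 -> R) (i j : 'I_n.+1) : R :=
  potential (theta j - theta i) -
  (potential (equal_angles j - equal_angles i) +
    residue_slope (j - i) *
      ((theta j - equal_angles j) - (theta i - equal_angles i))).

Lemma energy_gap_ge0 n (theta : 'I_n.+1 -> R) (i j : 'I_n.+1) :
  increasing_lap theta -> i != j -> 0 <= energy_gap theta i j.
Proof.
move=> lap ij; rewrite subr_ge0.
have [E|ne] := eqVneq (theta j - theta i) (equal_angles j - equal_angles i).
  have -> : (theta j - equal_angles j) - (theta i - equal_angles i) = 0 by lra.
  by rewrite mulr0 addr0 E.
exact/ltW/potential_pair.
Qed.

(** The linear terms of the gaps cancel by [odd_slopes_balanced]. *)
Lemma angle_energyB n (theta : 'I_n.+1 -> R) :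
  angle_energy theta - angle_energy (@equal_angles n.+1) =
  \sum_(i < n.+1) \sum_(j < n.+1 | i != j) energy_gap theta i j.
Proof.
pose e i := theta i - equal_angles i.
have := odd_slopes_balanced e (@residue_slopeN n).
have -> : \sum_(i < n.+1) \sum_(j < n.+1) residue_slope (j - i) * (e j - e i) =
    \sum_(i < n.+1) \sum_(j < n.+1 | i != j)
      residue_slope (j - i) * (e j - e i).
  apply: eq_bigr => i _; rewrite (bigD1 i)//= (subrr (e i)) mulr0 add0r.
  by apply: eq_bigl => j; rewrite eq_sym.
move=> bal; rewrite /angle_energy -[LHS]subr0 -[X in _ - X]bal -!sumrB.
apply: eq_bigr => i _; rewrite -!sumrB; apply: eq_bigr => j _.
by rewrite /energy_gap /e; ring.
Qed.

Lemma equal_angles_energy_le n (theta : 'I_n.+1 -> R) : increasing_lap theta ->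
  angle_energy (@equal_angles n.+1) <= angle_energy theta.
Proof.
move=> lap; rewrite -subr_ge0 angle_energyB.
by apply: sumr_ge0 => i _; apply: sumr_ge0 => j; exact: energy_gap_ge0.
Qed.

Lemma angle_energy_le_eq n (theta : 'I_n.+1 -> R) : increasing_lap theta ->
  angle_energy theta <= angle_energy (@equal_angles n.+1) ->
  forall i j, theta j - theta i = equal_angles j - equal_angles i.
Proof.
move=> lap le i j; have [->|ij] := eqVneq i j; first by rewrite !subrr.
apply/eqP; apply: contraT => ne; have := potential_pair lap ij ne.
rewrite -subr_gt0 -/(energy_gap _ _ _).
have gap0 k : 0 <= \sum_(l < n.+1 | k != l) energy_gap theta k l.
  by apply: sumr_ge0 => l; exact: energy_gap_ge0.
have sum0 : \sum_(i < n.+1) \sum_(j < n.+1 | i != j) energy_gap theta i j = 0.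
  by apply/le_anti; rewrite sumr_ge0// andbT -angle_energyB subr_le0.
have rowi := psumr_eq0P (fun k _ => gap0 k) sum0 (erefl (true : bool)) (i := i).
rewrite (psumr_eq0P _ rowi) ?ltxx// => l; exact: energy_gap_ge0.
Qed.
End Energy.

(** * Equal spacing and the main theorem *)

Section EquallySpaced.
Variables (R : realType) (alpha : R) (n : nat) (theta : 'I_n.+1 -> R).
Variable w : {fset R * R}.
Hypothesis alpha_gt0 : 0 < alpha.
Hypothesis lap : increasing_lap theta.
Hypothesis pw : perm_eq w (points_at alpha theta).

Let gap : R := 2 * pi / n.+1%:R.

Let gap_gt0 : 0 < gap.
Proof. by rewrite divr_gt0 ?mulr_gt0 ?pi_gt0. Qed.

Let equal_angles_gap (i : 'I_n.+1) : equal_angles R i = gap * i%:R.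
Proof. by rewrite /equal_angles /gap mulrAC. Qed.

Let gapSn : gap * n.+1%:R = 2 * pi.
Proof. by rewrite /gap divfK// pnatr_eq0. Qed.

(** No point of w lies strictly between those of angles theta i and
    theta (i + 1), so they are consecutive in the geometric sense. *)
Lemma equally_spaced_step (i : 'I_n.+1) (Si : (i.+1 < n.+1)%N) :
  equally_spaced alpha n.+1 w -> theta (Ordinal Si) - theta i = gap.
Proof.
set j := Ordinal Si; set h := theta j - theta i => es.
have [h0 h2] : 0 < h /\ h < 2 * pi by apply/andP/lap.
have al0 : alpha != 0 by rewrite gt_eqF.
suff /es E : are_consecutive alpha w (circle_point alpha (theta i))
    (circle_point alpha (theta j)) h.
  by apply: (mulfI al0); rewrite E /gap; ring.
have inw k : circle_point alpha (theta k) \in w.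
  by rewrite (perm_mem pw) mem_points_at.
split=> //; exists (theta i); first split=> //.
- by rewrite !ltW.
- by congr circle_point; rewrite /h; ring.
move=> u /andP[u0 uh]; apply/negP; rewrite (perm_mem pw) => /mapP[k _].
have [ki|ik] := leqP k i.
  have kj : (k < j)%N by [].
  have /andP[kj0 kj2] := lap kj.
  have le_ki : theta k <= theta i.
    move: ki; rewrite leq_eqVlt => /orP[/eqP/val_inj->//|/lap/andP[]]; lra.
  by move/(circle_point_inj al0); rewrite ltr_norml; move: uh; rewrite /h; lra.
have le_jk : theta j <= theta k.
  move: (ik : (j <= k)%N); rewrite leq_eqVlt.
  by move=> /orP[/eqP/val_inj->//|/lap/andP[]]; lra.
have /andP[ik0 ik2] := lap ik.
by move/(circle_point_inj al0); rewrite ltr_norml; move: uh; rewrite /h; lra.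
Qed.

Lemma equally_spaced_angles : equally_spaced alpha n.+1 w ->
  forall i j, theta j - theta i = equal_angles R j - equal_angles R i.
Proof.
move=> es; suff E m (mn : (m < n.+1)%N) :
    theta (Ordinal mn) = theta ord0 + gap * m%:R.
  by move=> [i ilt] [j jlt]; rewrite (E i) (E j) !equal_angles_gap /=; ring.
elim: m mn => [|m IH] mn.
  by rewrite mulr0 addr0; congr theta; exact: val_inj.
have mn' : (m < n.+1)%N by exact: ltnW.
have := @equally_spaced_step (Ordinal mn') mn es; rewrite IH.
by move=> step; rewrite -natr1; lra.
Qed.

(** Turning by 2 pi / (n + 1) from a point of w leads to a point of w again,
    so that no gap is larger. None is smaller: up to full turns, a gap is an
    integer multiple of 2 pi / (n + 1). *)
Lemma angles_equally_spaced :
  (forall i j, theta j - theta i = equal_angles R j - equal_angles R i) ->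
  equally_spaced alpha n.+1 w.
Proof.
have al0 : alpha != 0 by rewrite gt_eqF.
move=> eqt x y h [xw yw h0 [a [/andP[_ h2] xa yah] free]].
have thE i j : theta j = theta i + gap * (j%:R - i%:R).
  by have := eqt i j; rewrite !equal_angles_gap mulrBr; lra.
suff -> : h = gap by rewrite /gap; ring.
move: xw; rewrite (perm_mem pw) => /mapP[i _ xi].
move: yw; rewrite (perm_mem pw) => /mapP[j _ yj].
have rot u : circle_point alpha (a + u) = circle_point alpha (theta i + u).
  by apply: circle_pointD => //; rewrite -xa.
have next : circle_point alpha (a + gap) \in w.
  rewrite rot (perm_mem pw).
  have [ilt|] := ltnP i.+1 n.+1.
    have -> : theta i + gap = theta (Ordinal ilt).
      by rewrite (thE i (Ordinal ilt)) /= -natr1; ring.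
    by rewrite mem_points_at.
  (* The last point is followed by the first one, one turn further. *)
  move=> nilt; have ni : i = n :> nat.
    by apply/eqP; rewrite eqn_leq -ltnS ltn_ord.
  have -> : theta i + gap = theta ord0 + 2 * pi.
    by rewrite (thE ord0 i) /= -gapSn ni -natr1; ring.
  by rewrite circle_pointD2pi mem_points_at.
have hgap : h <= gap.
  rewrite leNgt; apply/negP => gh.
  by have := free gap; rewrite gap_gt0 gh next => /(_ isT).
apply/eqP; rewrite eq_le hgap /= leNgt; apply/negP => hlt.
have E : circle_point alpha (theta i + h) = circle_point alpha (theta j).
  by rewrite -rot -yah.
have jn : gap * j%:R <= gap * n%:R by rewrite ler_pM2l// ler_nat -ltnS.
have in_ : gap * i%:R <= gap * n%:R by rewrite ler_pM2l// ler_nat -ltnS.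
have j0 : 0 <= gap * j%:R by rewrite mulr_ge0// ltW.
have i0 : 0 <= gap * i%:R by rewrite mulr_ge0// ltW.
have gn : gap * n%:R + gap = 2 * pi by rewrite -gapSn -natr1; ring.
have hE : theta i + h = theta j.
  (* Since h < gap, this difference of angles is less than a full turn. *)
  apply: (circle_point_inj al0) E; rewrite (thE i j) mulrBr ltr_norml.
  by apply/andP; split; lra.
move: hE; rewrite (thE i j) mulrBr => hE.
have [ij|ji] := ltnP i j.
  have : gap * (i%:R + 1) <= gap * j%:R by rewrite ler_pM2l// natr1 ler_nat.
  lra.
have : gap * j%:R <= gap * i%:R by rewrite ler_pM2l// ler_nat.
lra.
Qed.
End EquallySpaced.

Theorem proposition2p2 (R : realType) (N : nat) (alpha s t : R)
    (hN : (2 <= N)%N)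
    (halpha : 0 < alpha < (expR 1 * pi)^-1)
    (hst : (0 < s /\ 0 <= t) \/ (s = 0 /\ 0 < t))
    (w : {fset R * R}) :
  is_minimal_configuration (circle alpha) (geodesic_distance alpha) s t N w
  <->
  (is_configuration (circle alpha) N w /\ equally_spaced alpha N w).
Proof.
case: N hN => // n _; case/andP: halpha => al0 al1.
have alpi : alpha * pi < expR (-1).
  rewrite -ltr_pdivlMr ?pi_gt0// expRN; move: al1.
  by rewrite invfM.
have energyE (v : {fset R * R}) (theta : 'I_n.+1 -> R) : increasing_lap theta ->
    perm_eq v (points_at alpha theta) ->
    log_energy (geodesic_distance alpha) s t v = angle_energy alpha s t theta.
  exact: log_energy_points_at.
have lap0 := @equal_angles_lap R n.+1.
split=> [[wconf wmin]|[wconf wes]]; (split; first exact: wconf).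
- have [theta lap pw] := configuration_points_at al0 wconf.
  have [w0 w0conf pw0] := points_at_configuration al0 lap0.
  apply: (angles_equally_spaced al0 pw).
  apply: (angle_energy_le_eq al0 alpi hst lap).
  by rewrite -(energyE _ _ lap pw) -(energyE _ _ lap0 pw0) wmin.
- have [theta lap pw] := configuration_points_at al0 wconf.
  have same := equally_spaced_angles al0 lap pw wes.
  move=> w' /(configuration_points_at al0)[theta' lap' pw'].
  rewrite (energyE _ _ lap pw) (energyE _ _ lap' pw').
  have -> : angle_energy alpha s t theta =
      angle_energy alpha s t (@equal_angles R n.+1).
    by apply: eq_bigr => i _; apply: eq_bigr => j _; rewrite same.
  exact: equal_angles_energy_le.
Qed.
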